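(* Let $\mathbf{K}$ be a field with $\operatorname{char}\mathbf{K}=0$ and let $F:\mathbf{K}^n\to\mathbf{K}^n$ be an invertible polynomial map of the form $F=x+H$, where $H$ is power linear of degree $d$. If $\operatorname{rank}JH=r$, then the inverse polynomial map of $F$ has degree at most $d^r$.
   Context: Here $n\ge 1$ and $x=(x_1,\dots,x_n)^t$ is the identity map. $H=(H_1,\dots,H_n)^t$ is power linear of degree $d$ (with $d\ge 2$ an integer) if $H=(Ax)^{*d}$ for some matrix $A\in \mathbf{K}^{n\times n}$, where $(Ax)^{*d}$ denotes the vector $((A^1x)^d,\dots,(A^nx)^d)^t$ and $A^i$ is the $i$-th row of $A$; that is, each component of $H$ is either zero or a $d$-th power of a linear form. A polynomial map $F=(F_1,\dots,F_n)^t$ with $F_i\in\mathbf{K}[x_1,\dots,x_n]$ is invertible if there is a polynomial map $\tilde F$ over $\mathbf{K}$ with $F\circ\tilde F=\tilde F\circ F=x$ (as tuples of polynomials). The degree of a polynomial map is the maximum of the degrees of its components. $JH=(\partial H_i/\partial x_j)_{1\le i,j\le n}$ is the Jacobian matrix of $H$, and its rank is taken over the field of rational functions $\mathbf{K}(x_1,\dots,x_n)$. *)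

(* Defs.v *)
From mathcomp Require Import all_boot all_order all_algebra.
From mathcomp Require Import mpoly.

Set Implicit Arguments.
Unset Strict Implicit.
Unset Printing Implicit Defensive.

Import GRing.Theory.
Local Open Scope ring_scope.

(* A polynomial map K^n -> K^n is the tuple of its n component polynomials;
   equality of polynomial maps is therefore equality of polynomials. *)
Notation polymap K n := (n.-tuple {mpoly K[n]}).

Definition idmap (K : fieldType) (n : nat) : polymap K n :=
  [tuple 'X_i | i < n].

Definition addmap (K : fieldType) (n : nat) (F G : polymap K n) : polymap K n :=
  [tuple tnth F i + tnth G i | i < n].

(* (F o G)(x) = F(G(x)) *)
Definition compmap (K : fieldType) (n : nat) (F G : polymap K n) :
  polymap K n := [tuple tnth F i \mPo G | i < n].

Definition is_inverse (K : fieldType) (n : nat) (F G : polymap K n) : Prop :=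
  compmap F G = idmap K n /\ compmap G F = idmap K n.

Definition invertible (K : fieldType) (n : nat) (F : polymap K n) : Prop :=
  exists G : polymap K n, is_inverse F G.

(* msize p is the total degree of p plus one, or 0 if p = 0; the zero
   polynomial thus gets degree 0 here. *)
Definition mapdeg (K : fieldType) (n : nat) (F : polymap K n) : nat :=
  \max_(i < n) (msize (tnth F i)).-1.

Definition linear_form (K : fieldType) (n : nat) (A : 'M[K]_n) (i : 'I_n) :
  {mpoly K[n]} := \sum_(j < n) A i j *: 'X_j.

Definition power_linear (K : fieldType) (n d : nat) (H : polymap K n) : Prop :=
  exists A : 'M[K]_n, H = [tuple linear_form A i ^+ d | i < n].

Definition jacobian (K : fieldType) (n : nat) (H : polymap K n) :
  'M[{mpoly K[n]}]_n := \matrix_(i < n, j < n) mderiv j (tnth H i).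

Definition jacobian_rank (K : fieldType) (n : nat) (H : polymap K n) : nat :=
  \rank (map_mx (@FracField.tofrac {mpoly K[n]}) (jacobian H)).

(* Main.v *)
Require Import Defs.
From mathcomp Require Import all_boot all_order all_algebra.
From mathcomp Require Import mpoly.
From mathcomp Require Import zify.

(* Factor A = BC through K^r, with r = rank A = rank JH. Then F descends along C to
   the automorphism f(u) = u + C(Bu)^{*d} of K^r, with inverse g say, and the inverse
   of F is y - (B g(Cy))^{*d}; so it suffices that deg g <= d^(r-1).
   This classical bound on the degree of the inverse is obtained here by counting
   monomials: if g_j has degree D and leading monomial a, then p |-> p(f) mod x_j is
   injective on the span of the monomials of degree <= N not divisible by a, because
   the kernel on all polynomials is the ideal (g_j). Its values are polynomials of
   degree <= dN in r - 1 variables, and comparing the two dimensions, asymptotically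
   D N^(r-1)/(r-1)! and (dN)^(r-1)/(r-1)!, gives D <= d^(r-1). *)

Set Implicit Arguments.
Unset Strict Implicit.
Unset Printing Implicit Defensive.

Import GRing.Theory.

(** * Elementary inequalities: comparing leading coefficients through growth *)

Lemma leq_expl (m n e : nat) : m <= n -> m ^ e <= n ^ e.
Proof. by case: e => // e; rewrite leq_exp2r. Qed.

(** Bernoulli's inequality (1 - t)^s >= 1 - s t at t = a / (M + a), cleared of denominators. *)
Lemma expnD_bernoulli (M a s : nat) :
  (M + a) ^ s.+1 <= M ^ s * (M + a) + s * a * (M + a) ^ s.
Proof.
elim: s => [|s IHs]; first by rewrite expn1 expn0 mul1n leq_addr.
have := leq_mul IHs (leqnn (M + a)).
have : M ^ s <= (M + a) ^ s by rewrite leq_expl ?leq_addr.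
rewrite !expnSr; set P := (M + a) ^ s; set Q := M ^ s; nia.
Qed.

Lemma leq_of_expn_asymptotic (D E a s : nat) :
  (forall M, D * M ^ s <= E * (M + a) ^ s) -> D <= E.
Proof.
move=> leDE; rewrite leqNgt; apply/negP => ltED.
(* If D > E, Bernoulli's inequality forces M + a <= (E + 1) s a, which this M exceeds. *)
pose M := (E.+1 * s * a).+1.
have := leDE M; have := expnD_bernoulli M a s.
have P_gt0 : 0 < (M + a) ^ s by rewrite expn_gt0 /M.
rewrite expnSr; set P := (M + a) ^ s in P_gt0 *; set Q := M ^ s => h1 h2.
have h3 : E.+1 * Q <= E * P by apply: leq_trans h2; rewrite leq_mul2r ltED orbT.
have h4 : E.+1 * (P * (M + a)) <= E * P * (M + a) + E.+1 * (s * a * P).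
  apply: leq_trans (leq_mul (leqnn E.+1) h1) _.
  by rewrite mulnDr leq_add2r mulnA leq_mul2r h3 orbT.
suff : P * (M + a) <= P * (E.+1 * s * a) by rewrite leq_pmul2l // /M; lia.
nia.
Qed.

(** As polynomials in M both sides have degree s, with leading coefficients D / s! and d^s / s!.
    Falling factorials are compared with powers to reach the previous lemma. *)
Lemma leq_of_bin_asymptotic (D d s : nat) : 0 < d ->
  (forall M, D * 'C(s + M, s) <= 'C(s + d * (M + D), s)) -> D <= d ^ s.
Proof.
move=> d_gt0 leD; apply: (@leq_of_expn_asymptotic _ _ (D + s) s) => M.
have ffact_ge k : M ^ k <= (k + M) ^_ k.
  elim: k => [|k IHk]; first by rewrite expn0 ffactn0.
  by rewrite addSn ffactSS expnS leq_mul //; lia.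
have ffact_le m k : m ^_ k <= m ^ k.
  elim: k m => [|k IHk] [|m] //; rewrite ffactSS expnS leq_mul //.
  by apply: leq_trans (IHk m) _; exact: leq_expl.
have := leq_mul (leD M) (leqnn s`!); rewrite -mulnA !bin_ffact => le1.
apply: leq_trans (leq_mul (leqnn D) (ffact_ge s)) _.
apply: leq_trans le1 _; apply: leq_trans (ffact_le _ _) _.
by rewrite -expnMn leq_expl //; nia.
Qed.

(** * Counting monomials of bounded degree *)

Lemma card_bmultinom (n b : nat) : #|{: 'X_{1..n < b.+1}}| = 'C(n + b, n).
Proof.
rewrite -card_partial_ord_partitions.
(* Exponent vectors correspond to the tuples over ['I_b.+1] with sum at most b, whose number is
   known. *)
pose f (m : 'X_{1..n < b.+1}) : n.-tuple 'I_b.+1 := [tuple inord (m i) | i < n].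
have mE (m : 'X_{1..n < b.+1}) i : (inord (m i) : 'I_b.+1) = m i :> nat.
  rewrite inordK //; have := bmdeg m; rewrite mdegE (bigD1 i) //=.
  by apply: leq_ltn_trans; rewrite leq_addr.
have f_inj : injective f.
  move=> m1 m2 eqf; apply/val_inj/mnmP => i.
  have /(congr1 (fun t => tnth t i)) := eqf; rewrite !tnth_mktuple.
  by move=> /(congr1 val); rewrite /= !mE.
rewrite -(card_codom f_inj); apply: eq_card => t; rewrite inE big_tuple.
apply/codomP/idP => [[m ->]|le_t].
  rewrite -ltnS (leq_trans _ (bmdeg m)) // ltnS mdegE.
  by apply: leq_sum => i _; rewrite tnth_mktuple mE.
pose m := [multinom (tnth t i : nat) | i < n].
have m_lt : mdeg m < b.+1.
  by rewrite ltnS mdegE (eq_bigr (fun i => tnth t i : nat)) // => i _; rewrite mnmE.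
exists (BMultinom m_lt); apply: eq_from_tnth => i; apply: ord_inj.
by rewrite tnth_mktuple mE mnmE.
Qed.

(** The strict bound admits b = 0, where both sides vanish. *)
Lemma card_bmultinomS (s b : nat) : #|{: 'X_{1..s.+1 < b}}| = 'C(s + b, s.+1).
Proof.
case: b => [|b]; last by rewrite card_bmultinom addSnnS.
by rewrite addn0 bin_small ?ltnSn //; apply: eq_card0 => -[m ltm0].
Qed.

(** Adding a is a bijection from the exponents of degree < b - |a| onto the multiples of a of degree
    < b. Truncated subtraction is correct here: there are no such multiples when |a| >= b. *)
Lemma card_bmultinom_ndvd (n b : nat) (a : 'X_{1..n}) :
  #|[set m : 'X_{1..n < b} | ~~ (a <= m)%MM]| + #|{: 'X_{1..n < b - mdeg a}}|
    = #|{: 'X_{1..n < b}}|.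
Proof.
rewrite -(cardsC [set m : 'X_{1..n < b} | ~~ (a <= m)%MM]); congr addn.
have add_lt (m : 'X_{1..n < b - mdeg a}) : mdeg (a + m) < b.
  by rewrite mdegD; have := bmdeg m; lia.
pose f m := BMultinom (add_lt m).
have f_inj : injective f.
  by move=> m1 m2 /(congr1 val) /= /addmI /val_inj.
rewrite -(card_codom f_inj); apply: eq_card => m; rewrite !inE negbK.
apply/codomP/idP => [[m' ->]|le_am]; first exact: lem_addr.
have sub_lt : mdeg (m - a) < b - mdeg a.
  by have := bmdeg m; rewrite -{1}(submK le_am) mdegD; lia.
by exists (BMultinom sub_lt); apply: val_inj; rewrite /= addmC submK.
Qed.

(** With D = |a|, the count is C(s+b+D, s+1) - C(s+b, s+1); Pascal's rule splits it into D terms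
    C(s+b+i, s), each at least C(s+b, s). *)
Lemma leq_card_bmultinom_ndvd (s b : nat) (a : 'X_{1..s.+1}) :
  mdeg a * 'C(s + b, s) <= #|[set m : 'X_{1..s.+1 < b + mdeg a} | ~~ (a <= m)%MM]|.
Proof.
have := card_bmultinom_ndvd (b + mdeg a) a; rewrite addnK !card_bmultinomS.
suff : mdeg a * 'C(s + b, s) + 'C(s + b, s.+1) <= 'C(s + (b + mdeg a), s.+1) by lia.
elim: (mdeg a) => [|D IHD]; first by rewrite mul0n addn0.
rewrite !addnS binS mulSn -addnA addnC leq_add //.
by rewrite leq_bin2l // leq_add2l leq_addr.
Qed.

(** These are the monomials of degree at most b in the other s variables. *)
Lemma card_bmultinom_ndvdU (s b : nat) (j : 'I_s.+1) :
  #|[set m : 'X_{1..s.+1 < b.+1} | ~~ (U_(j) <= m)%MM]| = 'C(s + b, s).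
Proof.
have := card_bmultinom_ndvd b.+1 U_(j); rewrite mdeg1 subn1 /= !card_bmultinomS.
by rewrite addnS binS; lia.
Qed.

Local Open Scope ring_scope.

(** * Degree bounds for sums, products and composites *)

Section MsizeBounds.
Variables (n : nat) (K : fieldType).
Implicit Types p q : {mpoly K[n]}.

(** The form [msize p <= a.+1] says deg p <= a and includes p = 0, whose [msize] is 0. *)
Lemma msizeM_bound p q (a b : nat) :
  (msize p <= a.+1 -> msize q <= b.+1 -> msize (p * q) <= (a + b).+1)%N.
Proof.
have [-> _ _|p0] := eqVneq p 0; first by rewrite mul0r msize0.
have [-> _ _|q0] := eqVneq q 0; first by rewrite mulr0 msize0.
by rewrite msizeM // ; move: (msize p) (msize q) => x y; clear; lia.
Qed.

Lemma msizeX_bound p (a k : nat) : 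
  (msize p <= a.+1)%N -> (msize (p ^+ k) <= (a * k).+1)%N.
Proof.
move=> lep; elim: k => [|k IHk]; first by rewrite expr0 msize1.
by rewrite exprS mulnS msizeM_bound.
Qed.

Lemma msizeD_bound p q (a : nat) : 
  (msize p <= a)%N -> (msize q <= a)%N -> (msize (p + q) <= a)%N.
Proof.
by move=> lep leq; apply: leq_trans (msizeD_le _ _) _; rewrite geq_max lep.
Qed.

Lemma msize_sum_bound (I : Type) (s : seq I) (P : pred I) (E : I -> {mpoly K[n]})
    (a : nat) :
  (forall i, P i -> msize (E i) <= a)%N -> (msize (\sum_(i <- s | P i) E i) <= a)%N.
Proof.
move=> leE; apply: (big_ind (fun p => (msize p <= a)%N)) => //.
  by rewrite msize0.
by move=> p q; apply: msizeD_bound.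
Qed.

End MsizeBounds.

Lemma msize_comp_bound (K : fieldType) (n k d : nat)
    (F : n.-tuple {mpoly K[k]}) (p : {mpoly K[n]}) (b : nat) :
  (forall i, msize (tnth F i) <= d.+1)%N -> (msize p <= b.+1)%N ->
  (msize (p \mPo F) <= (d * b).+1)%N.
Proof.
move=> leF lep; rewrite comp_mpolyE big_seq; apply: msize_sum_bound => m mp.
apply: leq_trans (msizeZ_le _ _) _.
have le_mb : (mdeg m <= b)%N by rewrite -ltnS (leq_trans (msize_mdeg_lt mp)).
suff : (msize (\prod_(i < n) tnth F i ^+ m i) <= (d * mdeg m).+1)%N.
  by move=> /leq_trans; apply; rewrite ltnS leq_mul2l le_mb orbT.
rewrite mdegE big_distrr /=.
apply: (big_rec2 (fun (p : {mpoly K[k]}) a => (msize p <= a.+1)%N)).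
  by rewrite msize1.
by move=> i a q _ le_q; apply: msizeM_bound => //; apply: msizeX_bound.
Qed.

Lemma comp_mpolyA (K : comNzRingType) (n k l : nat) (F : n.-tuple {mpoly K[k]})
    (G : k.-tuple {mpoly K[l]}) (p : {mpoly K[n]}) :
  (p \mPo F) \mPo G = p \mPo [tuple tnth F i \mPo G | i < n].
Proof.
rewrite [p \mPo F]comp_mpolyE [RHS]comp_mpolyE raddf_sum /=; apply: eq_bigr => m _.
rewrite comp_mpolyZ rmorph_prod /=; congr (_ *: _); apply: eq_bigr => i _.
by rewrite rmorphXn tnth_mktuple.
Qed.

Lemma mpolyX_dvd (K : comNzRingType) (n : nat) (j : 'I_n) (p : {mpoly K[n]}) :
  (forall m : 'X_{1..n}, ~~ (U_(j) <= m)%MM -> p@_m = 0) ->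
  exists s, p = 'X_j * s.
Proof.
move=> p_supp; exists (\sum_(m <- msupp p) p@_m *: 'X_[m - U_(j)]).
rewrite {1}[p]mpolyE mulr_sumr big_seq [RHS]big_seq; apply: eq_bigr => m.
rewrite mcoeff_msupp => pm; rewrite -scalerAr -mpolyXD addmC submK //.
by apply: contraNT pm => /p_supp ->.
Qed.

(** The matrix of [A] on X times Y has zero left kernel, so its rank #|X| is at most its number of
    columns. *)
Lemma card_le_of_linear_injective (K : fieldType) (I J : finType)
    (X : {set I}) (Y : {set J}) (A : I -> J -> K) :
  (forall c : I -> K, {in Y, forall j, \sum_(i in X) c i * A i j = 0} ->
     {in X, forall i, c i = 0}) ->
  (#|X| <= #|Y|)%N.
Proof.
move=> inj; pose M := \matrix_(i < #|X|, j < #|Y|) A (enum_val i) (enum_val j).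
suff : row_free M by rewrite /row_free => /eqP <-; apply: rank_leq_col.
rewrite -kermx_eq0; apply/rowV0P => v /sub_kermxP vM; apply/rowP => i0; rewrite mxE.
have Xi0 := enum_valP i0; rewrite -[i0](enum_valK_in Xi0).
apply: (inj (fun i => v 0 (enum_rank_in Xi0 i))) => // j Yj.
have /rowP/(_ (enum_rank_in Yj j)) := vM; rewrite !mxE => {2}<-.
rewrite big_enum_val; apply: eq_bigr => i _.
by rewrite !mxE enum_valK_in enum_rankK_in.
Qed.

(** * The classical degree bound for the inverse, by counting *)

Section InverseDegree.
Variables (K : fieldType) (s d : nat) (F G : polymap K s.+1).
Hypotheses (leF : (forall i, msize (tnth F i) <= d.+1)%N) (FG : is_inverse F G).

Lemma tnth_compmap_inverse i : tnth F i \mPo G = 'X_i /\ tnth G i \mPo F = 'X_i.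
Proof.
case: FG => /(congr1 (fun t => tnth t i)) + /(congr1 (fun t => tnth t i)).
by rewrite !tnth_mktuple.
Qed.

Lemma comp_mpoly_inverse p : (p \mPo F) \mPo G = p.
Proof.
rewrite comp_mpolyA -[RHS]comp_mpoly_id; congr (_ \mPo _).
by apply: eq_from_tnth => i; rewrite !tnth_mktuple; case: (tnth_compmap_inverse i).
Qed.

(* Modulo the ideal (x_j) = (G_j o F), the pullbacks by F of the monomials that are
   not divisible by the leading monomial of G_j stay linearly independent. *)
Lemma leq_card_standard_monomials j b :
  (#|[set m : 'X_{1..s.+1 < b.+1} | ~~ (mlead (tnth G j) <= m)%MM]|
    <= 'C(s + d * b, s))%N.
Proof.
rewrite -(@card_bmultinom_ndvdU s (d * b) j).
apply: (@card_le_of_linear_injective K _ _ _ _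
  (fun (m : 'X_{1..s.+1 < b.+1}) (m' : 'X_{1..s.+1 < (d * b).+1}) =>
     ('X_[m] \mPo F)@_m')) => c c0.
set X := [set m : 'X_{1..s.+1 < b.+1} | _] in c0 *.
pose p : {mpoly K[s.+1]} := \sum_(m in X) c m *: 'X_[m].
have pE k : p@_k = \sum_(m in X) c m * (m == k :> 'X_{1..s.+1})%:R.
  by rewrite raddf_sum; apply: eq_bigr => m _; rewrite /= mcoeffZ mcoeffX.
have p_size : (msize p <= b.+1)%N.
  apply: msize_sum_bound => m _; apply: leq_trans (msizeZ_le _ _) _.
  by rewrite msizeX bmdeg.
(* Beyond degree d b the coefficients vanish by the degree bound, up to d b by the hypothesis on
   c. *)
have pF0 k : ~~ (U_(j) <= k)%MM -> (p \mPo F)@_k = 0.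
  move=> ndvd_k; have [lt_k|le_k] := ltnP (mdeg k) (d * b).+1; last first.
    apply: memN_msupp_eq0; apply: msize_mdeg_ge; apply: leq_trans le_k.
    exact: msize_comp_bound.
  have k_in : BMultinom lt_k \in [set m : 'X_{1..s.+1 < (d * b).+1} | ~~ (U_(j) <= m)%MM].
    by rewrite inE.
  rewrite -[RHS](c0 _ k_in) /p (raddf_sum (comp_mpoly F)) raddf_sum /=.
  apply: eq_bigr => m _.
  by rewrite comp_mpolyZ mcoeffZ.
have [q pFE] := mpolyX_dvd pF0.
(* Composing p o F = x_j q with G turns x_j into G_j. *)
have pE' : p = tnth G j * (q \mPo G).
  by rewrite -[LHS]comp_mpoly_inverse pFE rmorphM /= comp_mpolyXU -tnth_nth.
(* The leading monomial of a nonzero multiple of G_j is divisible by that of G_j, but no monomial in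
   X is. *)
have p0 : p = 0.
  apply/eqP/negPn/negP => p_neq0; move: (p_neq0); rewrite {1}pE' mulf_eq0 negb_or.
  case/andP => G0 q0; have := mlead_supp p_neq0; rewrite mcoeff_msupp pE.
  rewrite big1 ?eqxx // => m Xm; case: eqP => [eq_m|_]; last by rewrite mulr0.
  by move: Xm; rewrite inE eq_m {1}pE' mleadM // lem_addr.
move=> m Xm; have := pE m; rewrite p0 mcoeff0 (bigD1 m) //= eqxx mulr1.
rewrite big1 ?addr0 // => m' /andP[_ neq_m']; case: eqP => [/val_inj eq_m|_].
  by rewrite eq_m eqxx in neq_m'.
by rewrite mulr0.
Qed.

Lemma msize_inverse_bound j : (0 < d)%N -> (msize (tnth G j) <= (d ^ s).+1)%N.
Proof.
move=> d_gt0; have [->|G0] := eqVneq (tnth G j) 0; first by rewrite msize0.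
(* The monomial order is graded, so D = deg G_j is the degree of the leading monomial. Counting up
   to degree N = M + D for every M yields the asymptotic comparison. *)
rewrite -mlead_deg // ltnS; apply: (leq_of_bin_asymptotic d_gt0) => M.
have := leq_card_standard_monomials j (M + mdeg (mlead (tnth G j))).
apply: leq_trans; rewrite -addSn; apply: leq_trans (leq_card_bmultinom_ndvd _ _).
by rewrite leq_mul2l leq_bin2l ?orbT // leq_add2l.
Qed.

End InverseDegree.

(** The [maxn 1] supplies the positive d of the counting bound without a proof that F is
    nonconstant. *)
Theorem mapdeg_inverse (K : fieldType) (n : nat) (F G : polymap K n) :
  is_inverse F G -> (mapdeg G <= maxn 1 (mapdeg F) ^ n.-1)%N.
Proof.
case: n => [|s] in F G * => FG; first by rewrite /mapdeg big_ord0.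
apply/bigmax_leqP => j _; rewrite -subn1 leq_subLR add1n.
apply: (msize_inverse_bound _ FG) => [i|]; last by rewrite leq_maxl.
apply: leq_trans (leqSpred _) _; rewrite ltnS leq_max.
by rewrite (bigmax_sup i) ?orbT.
Qed.

(** * Polynomial maps as columns, and the reduction to r variables *)

Section PolyColumns.
Variable K : fieldType.

(** Maps K^k -> K^n with k and n independent, since the reduction moves between K^n and K^r; linear
    maps then act by matrix products. *)
Notation polycol k n := 'cV[{mpoly K[k]}]_n.

Definition constmx (k m n : nat) (M : 'M[K]_(m, n)) : 'M[{mpoly K[k]}]_(m, n) :=
  map_mx (@mpolyC k K) M.

Definition varcol (n : nat) : polycol n n := \col_i 'X_i.

Definition powcol (d k n : nat) (P : polycol k n) : polycol k n :=
  map_mx (fun p => p ^+ d) P.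

Definition polymap_of_col (k n : nat) (P : polycol k n) : n.-tuple {mpoly K[k]} :=
  [tuple P i 0 | i < n].

Definition col_of_polymap (k n : nat) (F : n.-tuple {mpoly K[k]}) : polycol k n :=
  \col_i tnth F i.

Definition compcol (k l n : nat) (P : polycol k n) (v : polycol l k) : polycol l n :=
  map_mx (comp_mpoly (polymap_of_col v)) P.

Lemma constmxM k m n p (M : 'M_(m, n)) (N : 'M_(n, p)) :
  constmx k (M *m N) = constmx k M *m constmx k N.
Proof. exact: map_mxM. Qed.

Lemma constmx1 k n : constmx k 1%:M = 1%:M :> 'M_n.
Proof. exact: map_mx1. Qed.

Lemma compcolD k l n (P Q : polycol k n) (v : polycol l k) :
  compcol (P + Q) v = compcol P v + compcol Q v.
Proof. exact: map_mxD. Qed.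

Lemma compcol_constmx k l m n (M : 'M_(m, n)) (P : polycol k n) (v : polycol l k) :
  compcol (constmx k M *m P) v = constmx l M *m compcol P v.
Proof.
rewrite /compcol map_mxM; congr (_ *m _); apply/matrixP => i j.
by rewrite !mxE /= comp_mpolyC.
Qed.

Lemma compcol_powcol d k l n (P : polycol k n) (v : polycol l k) :
  compcol (powcol d P) v = powcol d (compcol P v).
Proof. by apply/matrixP => i j; rewrite !mxE rmorphXn. Qed.

Lemma compcol_varcol k l (v : polycol l k) : compcol (varcol k) v = v.
Proof.
by apply/colP => i; rewrite !mxE comp_mpolyXU -tnth_nth tnth_mktuple.
Qed.

Lemma compcol_id k n (P : polycol k n) : compcol P (varcol k) = P.
Proof.
apply/colP => i; rewrite mxE -[RHS]comp_mpoly_id; congr (_ \mPo _).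
by apply: eq_from_tnth => j; rewrite !tnth_mktuple mxE.
Qed.

Lemma compcolA k l m n (P : polycol k n) (v : polycol l k) (w : polycol m l) :
  compcol (compcol P v) w = compcol P (compcol v w).
Proof.
apply/colP => i; rewrite !mxE comp_mpolyA; congr (_ \mPo _).
by apply: eq_from_tnth => j; rewrite !tnth_mktuple mxE.
Qed.

Lemma polymap_of_colK k n : cancel (@polymap_of_col k n) (@col_of_polymap k n).
Proof. by move=> P; apply/colP => i; rewrite mxE tnth_mktuple. Qed.

Lemma col_of_polymapK k n : cancel (@col_of_polymap k n) (@polymap_of_col k n).
Proof. by move=> P; apply: eq_from_tnth => i; rewrite tnth_mktuple mxE. Qed.

Lemma col_of_compmap n (F G : polymap K n) :
  col_of_polymap (compmap F G) = compcol (col_of_polymap F) (col_of_polymap G).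
Proof. by apply/colP => i; rewrite !mxE tnth_mktuple col_of_polymapK. Qed.

Lemma col_of_idmap n : col_of_polymap (idmap K n) = varcol n.
Proof. by apply/colP => i; rewrite !mxE tnth_mktuple. Qed.

Lemma is_inverse_col n (F G : polymap K n) :
  is_inverse F G <->
  compcol (col_of_polymap F) (col_of_polymap G) = varcol n /\
  compcol (col_of_polymap G) (col_of_polymap F) = varcol n.
Proof.
rewrite -!col_of_compmap -col_of_idmap.
by split=> -[h1 h2]; split; rewrite ?h1 ?h2 //; apply: (can_inj (@col_of_polymapK _ _)).
Qed.

(* Conjugating x + (BCx)^d by the surjection C, with right inverse S, yields the map
   u + C(Bu)^d in only r variables; it is again invertible. *)
Section Reduction.
Variables (n r d : nat) (B : 'M[K]_(n, r)) (C : 'M[K]_(r, n)) (S : 'M[K]_(n, r)).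
Hypothesis CS : C *m S = 1%:M.

(** The value at an arbitrary column z, the map itself being the value at [varcol n]; substitution
    thus commutes with [powmap]. *)
Definition powmap (k : nat) (z : polycol k n) : polycol k n :=
  z + powcol d (constmx k (B *m C) *m z).

Definition redmap (k : nat) (v : polycol k r) : polycol k r :=
  v + constmx k C *m powcol d (constmx k B *m v).

Lemma compcol_powmap k l (z : polycol k n) (v : polycol l k) :
  compcol (powmap z) v = powmap (compcol z v).
Proof. by rewrite compcolD compcol_powcol compcol_constmx. Qed.

Lemma compcol_redmap k l (z : polycol k r) (v : polycol l k) :
  compcol (redmap z) v = redmap (compcol z v).
Proof. by rewrite compcolD compcol_constmx compcol_powcol compcol_constmx. Qed.

Lemma constmx_CS k : constmx k C *m constmx k S = 1%:M.
Proof. by rewrite -constmxM CS constmx1. Qed.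

Variable G : polycol n n.
Hypotheses (FG : powmap G = varcol n) (GF : compcol G (powmap (varcol n)) = varcol n).

(** The inverse g = C o G o S of f: from f o C = C o F follows f o g = C o F o G o S = CS = 1. *)
Definition redinv : polycol r r :=
  constmx r C *m compcol G (constmx r S *m varcol r).

Lemma compcol_G_powmap k (z : polycol k n) : compcol G (powmap z) = z.
Proof.
by rewrite -[X in powmap X]compcol_varcol -compcol_powmap -compcolA GF compcol_varcol.
Qed.

Lemma redmap_redinv : redmap redinv = varcol r.
Proof.
rewrite /redmap /redinv; set w := compcol G _.
rewrite [constmx r B *m _]mulmxA -constmxM -mulmxDr -/(powmap w).
by rewrite -compcol_powmap FG compcol_varcol mulmxA constmx_CS mul1mx.
Qed.

Lemma redinv_redmap : compcol redinv (redmap (varcol r)) = varcol r.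
Proof.
rewrite compcol_constmx compcolA compcol_constmx compcol_varcol.
set f := redmap _; set h := powcol d (constmx r B *m varcol r).
(* This z is G(S f(u)): since Cz = f(u) - C(Bu)^{*d} = u, F(z) = z + (Bu)^{*d} = S f(u). *)
pose z := constmx r S *m f - h.
have Cz : constmx r C *m z = varcol r.
  by rewrite mulmxBr mulmxA constmx_CS mul1mx /f /redmap addrK.
have -> : constmx r S *m f = powmap z.
  by rewrite /powmap constmxM -mulmxA Cz subrK.
by rewrite compcol_G_powmap.
Qed.

(** Let z be the right-hand side and h = g(Cy). As f(h) = Cy, Cz = h, so F(z) = z + (Bh)^{*d} = y
    and z = G(y). *)
Lemma powmap_inverseE :
  G = varcol n - powcol d (constmx n B *m compcol redinv (constmx n C *m varcol n)).
Proof.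
set h := compcol redinv _; set z := _ - _.
have hE : redmap h = constmx n C *m varcol n.
  by rewrite -compcol_redmap redmap_redinv compcol_varcol.
have Cz : constmx n C *m z = h.
  by rewrite /z mulmxBr -hE /redmap addrK.
rewrite -[z]compcol_G_powmap -[LHS]compcol_id; congr compcol.
by rewrite /powmap constmxM -mulmxA Cz subrK.
Qed.

End Reduction.
End PolyColumns.

(** * Degree of the inverse of x + (BCx)^{*d} *)

Section Degrees.
Variable K : fieldType.

Lemma msize_constmx_bound k m n (M : 'M[K]_(m, n)) (P : 'cV[{mpoly K[k]}]_n) (b : nat) :
  (forall i, msize (P i 0%R) <= b)%N -> forall i, (msize ((constmx k M *m P) i 0%R) <= b)%N.
Proof.
move=> leP i; rewrite mxE; apply: msize_sum_bound => j _.
by rewrite mxE mul_mpolyC; apply: leq_trans (msizeZ_le _ _) (leP j).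
Qed.

Lemma msize_varcol n i : msize (varcol K n i 0) = 2.
Proof. by rewrite mxE msizeX mdeg1. Qed.

Lemma mapdeg_redmap n r d (B : 'M[K]_(n, r)) (C : 'M[K]_(r, n)) : (0 < d)%N ->
  (mapdeg (polymap_of_col (redmap d B C (varcol K r))) <= d)%N.
Proof.
move=> d_gt0; apply/bigmax_leqP => i _; rewrite -subn1 leq_subLR add1n tnth_mktuple.
rewrite mxE msizeD_bound ?msize_varcol ?ltnS //.
apply: msize_constmx_bound => j; rewrite mxE -[X in (_ <= X.+1)%N]mul1n.
by apply: msizeX_bound; apply: msize_constmx_bound => l; rewrite msize_varcol.
Qed.

(** In G(y) = y - (B g(Cy))^{*d}, deg g <= d^(r-1) by the classical bound for f in r variables, and
    the power contributes one more factor d. *)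
Lemma mapdeg_powmap_inverse n r d (B : 'M[K]_(n, r)) (C : 'M[K]_(r, n))
    (S : 'M[K]_(n, r)) (G : polymap K n) :
  C *m S = 1%:M -> (0 < d)%N ->
  is_inverse (polymap_of_col (powmap d B C (varcol K n))) G ->
  (mapdeg G <= d ^ r)%N.
Proof.
move=> CS d_gt0 /is_inverse_col; rewrite polymap_of_colK compcol_powmap compcol_varcol.
move=> [FG GF]; set h := redinv C S (col_of_polymap G).
have inv_h : is_inverse (polymap_of_col (redmap d B C (varcol K r))) (polymap_of_col h).
  apply/is_inverse_col; rewrite !polymap_of_colK compcol_redmap compcol_varcol.
  by split; [apply: redmap_redinv | apply: redinv_redmap].
have h_deg j : (msize (h j 0%R) <= (d ^ r.-1).+1)%N.
  rewrite -[(d ^ _).+1]add1n -leq_subLR subn1.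
  apply: leq_trans (_ : mapdeg (polymap_of_col h) <= _)%N.
    by rewrite /mapdeg (bigmax_sup j) // tnth_mktuple.
  apply: leq_trans (mapdeg_inverse inv_h) _.
  by rewrite leq_expl // geq_max d_gt0 mapdeg_redmap.
have hC_deg j : (msize (compcol h (constmx n C *m varcol K n) j 0%R)
    <= (d ^ r.-1).+1)%N.
  rewrite mxE -[X in (_ <= X.+1)%N]mul1n; apply: msize_comp_bound => // i.
  by rewrite tnth_mktuple msize_constmx_bound // => l; rewrite msize_varcol.
apply/bigmax_leqP => i _; rewrite -subn1 leq_subLR add1n.
have -> : tnth G i = col_of_polymap G i 0 by rewrite mxE.
rewrite (powmap_inverseE CS FG GF) mxE msizeD_bound //.
  by rewrite msize_varcol ltnS expn_gt0 d_gt0.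
rewrite mxE msizeN mxE -/h.
(* For r = 0 the exponent [r.-1] is truncated and d^(r-1) d = d^r fails; there B has no columns, so
   the power term is 0. *)
have [r0|r_gt0] := posnP r.
  rewrite mxE big1 => [|[l lt_l] _]; last by exfalso; rewrite r0 in lt_l.
  by rewrite expr0n gtn_eqF // msize0.
have -> : (d ^ r = d ^ r.-1 * d)%N by rewrite -expnSr prednK.
by apply: msizeX_bound; apply: msize_constmx_bound.
Qed.

(** * Rank of the Jacobian of a power linear map *)

Lemma mderivX_exp n (j : 'I_n) (p : {mpoly K[n]}) (k : nat) :
  mderiv j (p ^+ k) = (p ^+ k.-1 * mderiv j p) *+ k.
Proof.
elim: k => [|[|k] IHk]; first by rewrite expr0 -mpolyC1 mderivC mulr0n.
  by rewrite expr0 mul1r expr1 mulr1n.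
rewrite [in LHS]exprS mderivM IHk /= -mulrnAr mulrA -exprS mulrnAr.
by rewrite [mderiv j p * _]mulrC [in RHS]mulrS.
Qed.

Lemma mderiv_linear_form n (A : 'M[K]_n) i j : mderiv j (linear_form A i) = (A i j)%:MP.
Proof.
rewrite /linear_form raddf_sum /= (bigD1 j) //= big1 => [|l neq_lj].
  by rewrite mderivZ mderivX mnm1E eqxx -[X in (X - _)%MM]add0m addmK mpolyX0 scale1r -alg_mpolyC addr0.
by rewrite mderivZ mderivX mnm1E (negPf neq_lj) scale0r scaler0.
Qed.

(** By the chain rule JH = diag(d l_i^(d-1)) A, where l_i is the i-th linear form, and an invertible
    diagonal factor preserves the rank. *)
Lemma leq_rank_jacobian_power n d (A : 'M[K]_n) : (d%:R : K) != 0 ->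
  (\rank A <= jacobian_rank [tuple linear_form A i ^+ d | i < n])%N.
Proof.
move=> d_neq0; pose iota := @FracField.tofrac {mpoly K[n]}.
(* If l_i = 0, row i of A is zero and any diagonal entry fits; 1 keeps the factor invertible over
   the fraction field. *)
pose u i : {mpoly K[n]} :=
  if linear_form A i == 0 then 1 else linear_form A i ^+ d.-1 *+ d.
have u_neq0 i : u i != 0.
  rewrite /u; case: ifPn => [_|l_neq0]; first exact: oner_neq0.
  by rewrite -scaler_nat scaler_eq0 negb_or d_neq0 expf_neq0.
have JE : jacobian [tuple linear_form A i ^+ d | i < n]
    = diag_mx (\row_i u i) *m constmx n A.
  apply/matrixP => i j; rewrite mul_diag_mx !mxE tnth_mktuple mderivX_exp.
  rewrite mderiv_linear_form /u -mulrnAl; case: eqP => // l0.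
  by rewrite -mderiv_linear_form l0 mderiv0 !mulr0.
rewrite /jacobian_rank JE map_mxM map_diag_mx eqmxMfull.
  by rewrite /constmx -map_mx_comp mxrank_map.
rewrite row_full_unit unitmxE det_diag unitfE; apply/prodf_neq0 => i _.
by rewrite !mxE tofrac_eq0.
Qed.

End Degrees.

(* The degree bound from a rank factorisation of A *)
Local Close Scope ring_scope.

Theorem mainTheorem3 (K : fieldType) (charK0 : [pchar K]%R =i pred0)
    (n : nat) (n_ge1 : 1 <= n) (d : nat) (d_ge2 : 2 <= d)
    (F H : polymap K n) (F_def : F = addmap (idmap K n) H)
    (H_power : power_linear d H) (F_inv : invertible F)
    (r : nat) (rankJH : jacobian_rank H = r) :
  forall G : polymap K n, is_inverse F G -> mapdeg G <= d ^ r.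
Proof.
move=> G FG; case: H_power => A H_A.
have d_gt0 : (0 < d)%N by apply: leq_trans d_ge2.
have leq_rA : (\rank A <= r)%N.
  rewrite -rankJH H_A leq_rank_jacobian_power //.
  by rewrite ((pcharf0P _).1 charK0) -lt0n.
apply: leq_trans (_ : d ^ \rank A <= _); last by rewrite leq_pexp2l.
(* A = BC with B = [col_base A] and C = [row_base A]; the rows of C are independent, so its
   pseudoinverse is a right inverse S. *)
apply: (@mapdeg_powmap_inverse _ n _ d (col_base A) (row_base A) (pinvmx (row_base A))) => //.
  by rewrite mulmxVp ?row_base_free.
suff <- : F = polymap_of_col (powmap d (col_base A) (row_base A) (varcol K n)) by [].
rewrite F_def H_A /powmap mulmx_base; apply: eq_from_tnth => i.
rewrite !tnth_mktuple !mxE.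
congr (_ + _ ^+ d)%R; apply: eq_bigr => j _.
by rewrite !mxE mul_mpolyC.
Qed.
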